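(* Let $U \ge 1$, let $U^{pre}_\checkmark \subseteq [U]$ be a set of pretrusted users, let $\mathcal V \subseteq [U]\times[U]$ be a set of vouches, let $\mathrm{trust} \in \mathbb R^U$ be the LipschiTrust trust vector computed from $(U^{pre}_\checkmark, \mathcal V)$ with decay $\beta \in (0,1)$, and for a user $u \in [U]$ let $\mathrm{trust}^{-u}\in \mathbb R^U$ be the trust vector computed after removing all of user $u$'s vouches. Then for every $u \in [U]$, $$\left\| \mathrm{trust} - \mathrm{trust}^{-u} \right\|_1 \le \frac{\beta}{1-\beta}\, \mathrm{trust}^{-u}_u .$$
   Context: $[U]=\{1,\dots,U\}$ is the set of users. A pair $(u,v)\in\mathcal V$ means that user $u$ vouches for user $v$. Fix a sink-vouch parameter $s > 0$. The vouch matrix $V \in \mathbb R^{U\times U}$ is defined by $V_{uv} = 1/\left(s + |\{k : (u,k)\in\mathcal V\}|\right)$ if $(u,v)\in\mathcal V$, and $V_{uv}=0$ otherwise (so $V$ has nonnegative entries and each row sums to at most $1$). The pretrust vector $p\in\mathbb R^U$ has $p_u = 1$ if $u\in U^{pre}_\checkmark$ and $p_u=0$ otherwise. Fix $\beta\in(0,1)$. LipschiTrust is the iteration $\mathrm{tr}^0 = p$, $\mathrm{tr}^{t+1} = \min\{p + \beta V^T \mathrm{tr}^t, 1\}$ (minimum taken coordinatewise), and the trust vector is $\mathrm{trust} = \lim_{t\to\infty} \mathrm{tr}^t$ (the limit exists). The vector $\mathrm{trust}^{-u}$ is obtained by the same construction with the same $p$, $\beta$, $s$, but with $\mathcal V$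 replaced by $\{(a,b)\in\mathcal V : a\ne u\}$; equivalently, $V$ is replaced by the matrix $V^{-u}$ obtained from $V$ by setting row $u$ to zero. *)

(* Defs.v *)
From HB Require Import structures.
From mathcomp Require Import all_boot all_order all_algebra.
From mathcomp Require Import all_classical all_reals all_analysis.

Set Implicit Arguments.
Unset Strict Implicit.
Unset Printing Implicit Defensive.

Import Order.TTheory GRing.Theory Num.Theory.
Import numFieldNormedType.Exports.

Local Open Scope ring_scope.

(* Users are the elements of 'I_U (numbered from 0); (u, v) \in vouches means
   that u vouches for v. *)

Definition vouch_mx (R : realType) (U : nat) (s : R)
    (vouches : {set 'I_U * 'I_U}) : 'M[R]_U :=
  \matrix_(u, v)
    if (u, v) \in vouches then 1 / (s + #|[set k | (u, k) \in vouches]|%:R)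
    else 0.

Definition pretrust (R : realType) (U : nat) (Upre : {set 'I_U}) : 'cV[R]_U :=
  \col_u if u \in Upre then 1 else 0.

Fixpoint lipschitrust_iter (R : realType) (U : nat) (beta s : R)
    (Upre : {set 'I_U}) (vouches : {set 'I_U * 'I_U}) (t : nat) : 'cV[R]_U :=
  match t with
  | 0%N => pretrust R Upre
  | t'.+1 =>
      map2_mx Num.min
        (pretrust R Upre + beta *: ((vouch_mx s vouches)^T
           *m lipschitrust_iter beta s Upre vouches t'))
        (const_mx 1)
  end.

(* The limit is taken in the (coordinatewise) topology of 'cV[R]_U. *)
Definition trust (R : realType) (U : nat) (beta s : R)
    (Upre : {set 'I_U}) (vouches : {set 'I_U * 'I_U}) : 'cV[R]_U :=
  lim (lipschitrust_iter beta s Upre vouches t @[t --> \oo])%classic.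

Definition remove_vouches (U : nat) (u : 'I_U)
    (vouches : {set 'I_U * 'I_U}) : {set 'I_U * 'I_U} :=
  [set e in vouches | e.1 != u].

(* The library norm on matrices is the max norm, hence this definition. *)
Definition norm1 (R : realType) (U : nat) (x : 'cV[R]_U) : R :=
  \sum_(i < U) `|x i ord0|.

(* Main.v *)
(* Write x_t and y_t for the iterates with and without the vouches of u.
   Clipping at 1 is 1-Lipschitz and the rows of the vouch matrix sum to at most
   1, so ||x_(t+1) - y_(t+1)||_1 <= beta (||x_t - y_t||_1 + (y_t)_u): only row u
   differs, and it contributes at most (x_t)_u <= |(x_t - y_t)_u| + (y_t)_u.
   Since c = beta / (1 - beta) satisfies c = beta (c + 1) and (y_t)_u is
   nondecreasing in t, the bound ||x_t - y_t||_1 <= c (y_t)_u follows by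
   induction and passes to the limit. *)
Require Import Defs.
From mathcomp Require Import all_boot all_order all_algebra.
From mathcomp Require Import all_classical all_reals all_analysis.
From mathcomp Require Import ring lra.

Import Order.TTheory GRing.Theory Num.Theory.
Import numFieldNormedType.Exports.

Local Open Scope ring_scope.

(** A neighbourhood of [M] contains a box of entrywise neighbourhoods [P i j]; as there are finitely
    many index pairs, [F] satisfies all these conditions at once. *)
Lemma cvg_mx_entrywise (T : topologicalType) (m n : nat) (S : Type)
    (F : set_system S) (FF : Filter F) (f : S -> 'M[T]_(m, n)) (M : 'M[T]_(m, n)) :
  (forall i j, (f t i j @[t --> F] --> M i j)%classic) ->
  (f t @[t --> F] --> M)%classic.
Proof.
move=> fM A [P M_P sPA].
have FP : F (fun t => forall ij : 'I_m * 'I_n, P ij.1 ij.2 (f t ij.1 ij.2)).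
  by apply: filter_forall => -[i j]; exact: fM.
have PA : forall t, (forall ij : 'I_m * 'I_n, P ij.1 ij.2 (f t ij.1 ij.2)) -> A (f t).
  by move=> t Pt; apply: sPA => i j; exact: (Pt (i, j)).
exact: filterS PA FP.
Qed.

Lemma dist_minl (R : realDomainType) (a b c : R) :
  `|Num.min a c - Num.min b c| <= `|a - b|.
Proof.
wlog leab : a b / a <= b.
  move=> H; have [/H//|/ltW/H] := leP a b.
  by rewrite distrC (distrC b).
have leM : Num.min a c <= Num.min b c.
  by rewrite le_min !ge_min leab lexx orbT.
rewrite distrC (distrC a) !ger0_norm ?subr_ge0//.
by case: (leP a c); case: (leP b c); lra.
Qed.

Section LipschiTrust.
Variables (R : realType) (U : nat) (beta s : R) (Upre : {set 'I_U}).
Hypotheses (s_gt0 : 0 < s) (beta_gt0 : 0 < beta) (beta_lt1 : beta < 1).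
Implicit Type vouches : {set 'I_U * 'I_U}.

Lemma vouch_mx_ge0 vouches (a b : 'I_U) : 0 <= vouch_mx s vouches a b.
Proof.
rewrite mxE; case: ifP => // _.
by rewrite divr_ge0// addr_ge0// ltW.
Qed.

(** If [a] vouches for [n] users, the row has [n] entries equal to [1 / (s + n)], and
    [n <= s + n]. *)
Lemma vouch_mx_row_sum_le1 vouches (a : 'I_U) :
  \sum_b vouch_mx s vouches a b <= 1.
Proof.
under eq_bigr do rewrite mxE.
rewrite -big_mkcond/= sumr_const mul1r.
set n := #|[set k | _]|; have -> : #|[pred b | (a, b) \in vouches]| = n.
  by apply: eq_card => b; rewrite !inE.
have sn_gt0 : 0 < s + n%:R by rewrite ltr_wpDr.
by rewrite -[_^-1 *+ _]mulr_natl ler_pdivrMr// mul1r ler_wpDl// ltW.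
Qed.

(** Removing the vouches of [u] does not change how many users any other user vouches for, so the
    denominators in the other rows stay the same. *)
Lemma vouch_mx_remove vouches (u a b : 'I_U) :
  vouch_mx s (remove_vouches u vouches) a b =
  if a == u then 0 else vouch_mx s vouches a b.
Proof.
rewrite !mxE !inE/=; have [->|au] := eqVneq a u; first by rewrite andbF.
rewrite andbT; congr (if _ then 1 / (s + _%:R) else _).
by apply: eq_card => k; rewrite !inE/= au andbT.
Qed.

Local Notation tr vouches t := (lipschitrust_iter beta s Upre vouches t).

Lemma lipschitrust_iterS vouches (t : nat) (i : 'I_U) :
  tr vouches t.+1 i ord0 =
  Num.min (pretrust R Upre i ord0
           + beta * \sum_j vouch_mx s vouches j i * tr vouches t j ord0) 1.
Proof.
rewrite /= !mxE; congr (Num.min (_ + _ * _) _).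
by apply: eq_bigr => j _; rewrite mxE.
Qed.

Lemma pretrust_ge0 (i : 'I_U) : 0 <= pretrust R Upre i ord0.
Proof. by rewrite mxE; case: ifP. Qed.

Lemma pretrust_le1 (i : 'I_U) : pretrust R Upre i ord0 <= 1.
Proof. by rewrite mxE; case: ifP. Qed.

Lemma lipschitrust_iter_ge0 vouches (t : nat) (i : 'I_U) :
  0 <= tr vouches t i ord0.
Proof.
elim: t i => [|t IH] i; first exact: pretrust_ge0.
rewrite lipschitrust_iterS le_min ler01 andbT.
rewrite addr_ge0 ?pretrust_ge0// mulr_ge0 ?(ltW beta_gt0)// sumr_ge0// => j _.
by rewrite mulr_ge0// vouch_mx_ge0.
Qed.

Lemma lipschitrust_iter_le1 vouches (t : nat) (i : 'I_U) :
  tr vouches t i ord0 <= 1.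
Proof.
case: t => [|t]; first exact: pretrust_le1.
by rewrite lipschitrust_iterS ge_min lexx orbT.
Qed.

(** The first update adds a nonnegative term to a vector already at most 1; afterwards order is
    preserved because the vouch matrix has nonnegative entries and clipping is monotone. *)
Lemma lipschitrust_iter_leS vouches (t : nat) (i : 'I_U) :
  tr vouches t i ord0 <= tr vouches t.+1 i ord0.
Proof.
elim: t i => [|t IH] i.
  rewrite lipschitrust_iterS le_min pretrust_le1 andbT lerDl.
  rewrite mulr_ge0 ?(ltW beta_gt0)// sumr_ge0// => j _.
  by rewrite mulr_ge0 ?vouch_mx_ge0 ?pretrust_ge0.
rewrite !lipschitrust_iterS le_min !ge_min lexx orbT andbT lerD2l.
rewrite (ler_pM2l beta_gt0) ler_sum// => j _.
by rewrite ler_wpM2l ?vouch_mx_ge0.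
Qed.

Lemma cvg_trust vouches (i : 'I_U) :
  (tr vouches t i ord0 @[t --> \oo] --> trust beta s Upre vouches i ord0)%classic.
Proof.
have cvg_entry (j : 'I_U) : cvgn (fun t => tr vouches t j ord0).
  apply: nondecreasing_is_cvgn.
    by apply/nondecreasing_seqP => t; exact: lipschitrust_iter_leS.
  by exists 1 => _ [t _ <-]; exact: lipschitrust_iter_le1.
(* [trust] is a [lim] of column vectors, so the vector sequence itself must be shown to converge;
   the column of entrywise limits is the witness. *)
have cvg_tr : cvgn (fun t => tr vouches t).
  apply/cvg_ex.
  exists (\col_j limn (fun t => tr vouches t j ord0)).
  by apply: cvg_mx_entrywise => j k; rewrite mxE ord1; exact: cvg_entry.
have := cvg_comp _ _ cvg_tr (@coord_continuous R U 1 i ord0 (limn (fun t => tr vouches t))).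
exact.
Qed.

Lemma norm1_lipschitrust_iterS vouches (u : 'I_U) (t : nat) :
  norm1 (tr vouches t.+1 - tr (remove_vouches u vouches) t.+1) <=
  beta * (norm1 (tr vouches t - tr (remove_vouches u vouches) t)
          + tr (remove_vouches u vouches) t u ord0).
Proof.
set W := remove_vouches u vouches.
(* [d i j] is the change in what [j] passes on to [i], before decay and clipping. *)
pose d i j := vouch_mx s vouches j i * tr vouches t j ord0
              - vouch_mx s W j i * tr W t j ord0.
have subE (x y : 'cV[R]_U) i : (x - y) i ord0 = x i ord0 - y i ord0.
  by rewrite !mxE.
have step (i : 'I_U) :
    `|(tr vouches t.+1 - tr W t.+1) i ord0| <= beta * \sum_j `|d i j|.
  rewrite subE !lipschitrust_iterS.
  apply: le_trans (dist_minl _ _ _ _) _.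
  rewrite opprD addrACA subrr add0r -mulrBr -sumrB normrM (gtr0_norm beta_gt0).
  by rewrite (ler_pM2l beta_gt0) ler_norm_sum.
rewrite /norm1; apply: le_trans (ler_sum _ (fun i _ => step i)) _.
rewrite -mulr_sumr (ler_pM2l beta_gt0) exchange_big/=.
(* Spreading this term over [j] makes both sides sums over the voucher [j], to be compared term by
   term. *)
have -> : tr W t u ord0 = \sum_j (if j == u then tr W t j ord0 else 0).
  by rewrite -big_mkcond big_pred1_eq.
rewrite -big_split/=; apply: ler_sum => j _.
have row (e : R) :
    0 <= e -> \sum_i vouch_mx s vouches j i * e <= e.
  by move=> e0; rewrite -mulr_suml ler_piMl// vouch_mx_row_sum_le1.
rewrite subE /d.
under eq_bigr do rewrite vouch_mx_remove.
have [->|ju] := eqVneq j u; last first.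
  under eq_bigr do rewrite -mulrBr normrM (ger0_norm (vouch_mx_ge0 _ _ _)).
  by rewrite addr0 row.
(* For [j = u] the second row is zero, so all that [u] passes on counts as change. *)
under eq_bigr do rewrite mul0r subr0 normrM (ger0_norm (vouch_mx_ge0 _ _ _)).
rewrite -mulr_suml; apply: le_trans (ler_piMl _ (vouch_mx_row_sum_le1 _ _)) _ => //.
rewrite -{2}(ger0_norm (lipschitrust_iter_ge0 W t u)).
by apply: le_trans (ler_normD _ _); rewrite subrK.
Qed.

Lemma norm1_lipschitrust_iter vouches (u : 'I_U) (t : nat) :
  norm1 (tr vouches t - tr (remove_vouches u vouches) t) <=
  beta / (1 - beta) * tr (remove_vouches u vouches) t u ord0.
Proof.
have c_ge0 : 0 <= beta / (1 - beta) by rewrite divr_ge0 ?subr_ge0// ltW.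
elim: t => [|t IH].
  rewrite /norm1 big1 => [|i _].
    by apply: mulr_ge0 => //; exact: lipschitrust_iter_ge0.
  by rewrite subrr mxE normr0.
apply: le_trans (norm1_lipschitrust_iterS _ _ _) _.
apply: le_trans (ler_wpM2l c_ge0 (lipschitrust_iter_leS _ t u)).
set y := lipschitrust_iter _ _ _ _ _ u ord0 in IH *.
have -> : beta / (1 - beta) * y = beta * (beta / (1 - beta) * y + y).
  by field; rewrite subr_eq0 gt_eqF.
by rewrite (ler_pM2l beta_gt0) lerD2r.
Qed.

End LipschiTrust.

Theorem theorem3p2 (R : realType) (U : nat) (beta s : R)
    (Upre : {set 'I_U}) (vouches : {set 'I_U * 'I_U})
    (hU : (1 <= U)%N) (hs : 0 < s) (hbeta0 : 0 < beta) (hbeta1 : beta < 1)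
    (u : 'I_U) :
  norm1 (trust beta s Upre vouches
         - trust beta s Upre (remove_vouches u vouches))
  <= beta / (1 - beta)
     * trust beta s Upre (remove_vouches u vouches) u ord0.
Proof.
pose tr v t := lipschitrust_iter beta s Upre v t.
set W := remove_vouches u vouches.
have cvg_tr v i : (tr v t i ord0 @[t --> \oo] --> trust beta s Upre v i ord0)%classic.
  exact: cvg_trust.
(* [norm1] is a finite sum of absolute values of entries, so entrywise convergence is enough. *)
have cvgl : (norm1 (tr vouches t - tr W t) @[t --> \oo] -->
    norm1 (trust beta s Upre vouches - trust beta s Upre W))%classic.
  rewrite /norm1; apply: cvg_big => [|i _]; first exact: add_continuous.
  apply: cvg_norm.
  rewrite !mxE; under eq_cvg do rewrite !mxE.
  by apply: cvgB; exact: cvg_tr.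
have cvgr := cvgMl_tmp (a := beta / (1 - beta)) (cvg_tr W u).
apply: (ler_cvg_to cvgl (cvgr _)).
by apply: nearW => t; exact: norm1_lipschitrust_iter.
Qed.
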